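(* Let $N(t)$, $t\ge0$, be a homogeneous Poisson process of rate $\lambda>0$. For every $t>0$ and every integer $n\ge0$, $$\mathbb E\left\{\left[\int_0^t N(s)\,\mathrm ds\right]^2\,\Bigg|\,N(t)=n\right\}=\frac{n(3n+1)t^2}{12}\qquad\text{and}\qquad \operatorname{Var}\left\{\int_0^t N(s)\,\mathrm ds\,\Bigg|\,N(t)=n\right\}=\frac{n t^2}{12} .$$
   Context: $\operatorname{Var}\{\,\cdot\,|\,N(t)=n\}$ is the variance under the conditional probability given the event $\{N(t)=n\}$. *)

(* Defs.v *)
From HB Require Import structures.
From mathcomp Require Import all_boot all_order all_algebra.
From mathcomp Require Import all_classical all_reals all_analysis.

Set Implicit Arguments.
Unset Strict Implicit.
Unset Printing Implicit Defensive.

Import Order.TTheory GRing.Theory Num.Theory.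
Import numFieldNormedType.Exports.

Local Open Scope classical_set_scope.
Local Open Scope ring_scope.

(* Letting some of the [B i] be [setT] gives the product rule for subfamilies. *)
Definition mutually_independent d d' (T : measurableType d)
    (T' : measurableType d') (R : realType) (P : probability T R)
    (I : finType) (X : I -> T -> T') : Prop :=
  forall B : I -> set T', (forall i, measurable (B i)) ->
    P (\bigcap_(i in [set: I]) (X i @^-1` B i)) =
    (\prod_(i : I) P (X i @^-1` B i))%E.

(* Only the times t >= 0 are constrained. The truncated subtraction of nat is
   harmless in the increments, since they are taken along nondecreasing paths;
   the topology of nat is discrete in [poisson_right_continuous]. *)
Record poisson_process d (T : measurableType d) (R : realType)
    (P : probability T R) (lambda : R) (N : R -> {RV P >-> nat}) : Prop := {
  poisson_start : forall w, N 0 w = 0%N;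
  poisson_nondecreasing : forall w s t, 0 <= s -> s <= t ->
    (N s w <= N t w)%N;
  poisson_right_continuous : forall w t, 0 <= t ->
    N s w @[s --> t^'+] --> N t w;
  poisson_independent_increments : forall (m : nat) (u : nat -> R),
    0 <= u 0%N -> nondecreasing_seq u ->
    mutually_independent P
      (fun (i : 'I_m) (w : T) => (N (u i.+1) w - N (u i) w)%N);
  poisson_increment_law : forall s t, 0 <= s -> s < t -> forall k : nat,
    P [set w | (N t w - N s w)%N = k] =
    (poisson_pmf (lambda * (t - s)) k)%:E }.

(* U |-> P (U `&` A) / P A when P A <> 0 (and, by convention, P otherwise). *)
Definition cond_prob d (T : measurableType d) (R : realType)
    (P : probability T R) (A : set T) (mA : measurable A) : probability T R :=
  mnormalize (mrestr P mA) P.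

Lemma measurable_count_eq d (T : measurableType d) (R : realType)
    (P : probability T R) (X : {RV P >-> nat}) (n : nat) :
  measurable [set w | X w = n].
Proof. exact: (measurable_funPTI X (Y := [set n])). Qed.

Definition path_integral d (T : measurableType d) (R : realType)
    (P : probability T R) (N : R -> {RV P >-> nat}) (t : R) (w : T) : R :=
  \int[lebesgue_measure]_(s in `[0, t]) (N s w)%:R.

(* Main.v *)
Require Import Defs.
From mathcomp Require Import all_boot all_order all_algebra.
From mathcomp Require Import all_classical all_reals all_analysis.
From mathcomp Require Import measurable_realfun.
From mathcomp Require Import ring lra zify.

Set Implicit Arguments.
Unset Strict Implicit.
Unset Printing Implicit Defensive.

Import Order.TTheory GRing.Theory Num.Theory.
Import numFieldNormedType.Exports.

Local Open Scope classical_set_scope.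
Local Open Scope ring_scope.

(** Write [I] for the integral of the path over [0, t], and [A] for the event
    that exactly [n] points fall in [0, t].

    Given [A], the [n] points behave like independent uniform points of [0, t],
    so the number of points in a subinterval of length [h] is binomial with
    parameters [n] and [h / t] ([poisson_cond_increment_law]).  That is obtained
    by cutting [0, t] at [a] and [b], using the independence of the three
    increments, and summing over the number of points before [a] with the
    binomial theorem.

    The one-increment law already determines all second moments of the path:
    for [a <= b],
      [2 N_a N_b = N_a ^ 2 + N_b ^ 2 - (N_b - N_a) ^ 2],
    and each square on the right is the square of one increment.  Hence
      [E(N_a N_b | A) = n (n - 1) (a / t) (b / t) + n min(a, b) / t]
    ([count_cond_product]).

    The integral is then reached without Fubini.  Paths are nondecreasing, so
    the right Riemann sum of mesh [t / m] exceeds [I] by at most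
    [(t / m) N_t] ([right_riemann_sum_error]).  In particular these sums, which
    are finite combinations of counts, converge to [I] on every path, and on
    [A] they all lie between [0] and [n t].  Their conditional moments of order
    one and two have closed forms in [1 / m]; by dominated convergence the limits
    [n t / 2] and [n (n - 1) t ^ 2 / 4 + n t ^ 2 / 3] are the moments of [I].
    The second one is the first claim, and the variance is
      [n (3 n + 1) t ^ 2 / 12 - (n t / 2) ^ 2 = n t ^ 2 / 12]. *)

(** * Riemann sums of a nondecreasing function *)

Lemma nondecreasing_integrable (R : realType) (f : R -> R) (a b : R) :
  {homo f : x y / x <= y} ->
  (@lebesgue_measure R).-integrable `[a, b] (EFin \o f).
Proof.
move=> f_nd; apply: measurable_bounded_integrable => //.
- by rewrite /= lebesgue_measure_itv /=; case: ifP => _; rewrite ?ltry.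
- exact: nondecreasing_measurable.
- exists (`|f a| + `|f b|); split; first exact: num_real.
  move=> M /= ltM x; rewrite /= in_itv /= => /andP[ax xb].
  have fa := f_nd _ _ ax; have fb := f_nd _ _ xb.
  have := ler_norm (f b); have := ler_norm (- f a); rewrite normrN => ha hb.
  have := normr_ge0 (f a); have := normr_ge0 (f b).
  by move=> ? ?; rewrite ler_norml; apply/andP; split; lra.
Qed.

Lemma nondecreasing_Rintegral_bounds (R : realType) (f : R -> R) (a b : R) :
  {homo f : x y / x <= y} -> a <= b ->
  (b - a) * f a <= \int[lebesgue_measure]_(x in `]a, b]) f x <= (b - a) * f b.
Proof.
move=> f_nd ab.
have If : (@lebesgue_measure R).-integrable `]a, b] (EFin \o f).
  apply: (integrableS _ _ _ (@nondecreasing_integrable _ f a b f_nd)) => //.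
  by apply: subset_itvr; rewrite bnd_simp.
have Icst c : (@lebesgue_measure R).-integrable `]a, b] (EFin \o cst c).
  apply: (integrableS _ _ _ (@nondecreasing_integrable _ (cst c) a b _)) => //.
  by apply: subset_itvr; rewrite bnd_simp.
have cstE c : \int[lebesgue_measure]_(x in `]a, b]) cst c x = (b - a) * c.
  rewrite Rintegral_cst//= lebesgue_measure_itv /= lte_fin.
  case: ltgtP ab => //= [_ _|-> _]; first by rewrite mulrC.
  by rewrite subrr mul0r mulr0.
by rewrite -!cstE; apply/andP; split; apply: le_Rintegral => //= x;
  rewrite in_itv /= => /andP[ax xb]; apply: f_nd => //; exact: ltW.
Qed.

Definition right_riemann_sum (R : realType) (f : R -> R) (h : R) (m : nat) : R :=
  h * \sum_(i < m) f (i.+1%:R * h).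

(** On each cell the sum exceeds the integral by at most [h] times the increase
    of [f] over the cell, and these increases telescope. *)
Lemma right_riemann_sum_error (R : realType) (f : R -> R) (h : R) (m : nat) :
  {homo f : x y / x <= y} -> 0 <= h ->
  0 <= right_riemann_sum f h m - \int[lebesgue_measure]_(x in `[0, m%:R * h]) f x
    <= h * (f (m%:R * h) - f 0).
Proof.
move=> f_nd h0; rewrite /right_riemann_sum; elim: m => [|m IHm].
  by rewrite big_ord0 mulr0 !mul0r set_itv1 Rintegral_set1 !subrr mulr0 lexx.
have mh0 : 0 <= m%:R * h by rewrite mulr_ge0.
have mS : m.+1%:R * h = m%:R * h + h by rewrite -natr1 mulrDl mul1r.
have le_mS : m%:R * h <= m.+1%:R * h by rewrite mS lerDl.
have step := @Rintegral_itvB R f (BLeft 0) (BRight (m.+1%:R * h)) (m%:R * h)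
  (@nondecreasing_integrable _ f _ _ f_nd).
rewrite !bnd_simp in step; have {}step := step mh0 le_mS.
have := @nondecreasing_Rintegral_bounds _ f _ _ f_nd le_mS.
rewrite -step big_ord_recr /= mulrDr.
have -> : m.+1%:R * h - m%:R * h = h by rewrite mS addrAC subrr add0r.
move: IHm.
set s := \sum_(i < m) _; set I0 := Rintegral _ _ _; set I1 := Rintegral _ _ _.
by move=> /andP[? ?] /andP[? ?]; apply/andP; split; lra.
Qed.

Lemma right_riemann_sum_cvg (R : realType) (f : R -> R) (t : R) :
  {homo f : x y / x <= y} -> 0 <= t ->
  right_riemann_sum f (t / m.+1%:R) m.+1 @[m --> \oo] -->
    \int[lebesgue_measure]_(x in `[0, t]) f x.
Proof.
move=> f_nd t0.
set I := Rintegral _ _ _.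
apply: (@squeeze_cvgr _ _ _ _ (cst I)
  (fun m => I + m.+1%:R^-1 * (t * (f t - f 0)))); last 2 first.
- exact: cvg_cst.
- rewrite -[X in _ --> X]addr0; apply: cvgD; first exact: cvg_cst.
  rewrite -[X in _ --> X](mul0r (t * (f t - f 0))).
  by apply: cvgMr_tmp; exact: cvg_harmonic.
apply: nearW => m /=.
have h0 : 0 <= t / m.+1%:R by rewrite divr_ge0.
have := @right_riemann_sum_error R f _ m.+1 f_nd h0.
have -> : m.+1%:R * (t / m.+1%:R) = t by rewrite mulrC divfK.
rewrite -/I => /andP[lo up]; rewrite -subr_ge0 lo /= -lerBlDl.
by rewrite (le_trans up)// mulrA (mulrC t).
Qed.

(** * Binomial moments and sums of minima *)

(** From [k 'C(n.+1, k) = n.+1 'C(n, k.-1)]: weighting a binomial law by its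
    value shifts it by one.  Each use lowers the degree of a moment by one. *)
Lemma sum_binomial_size_bias (R : comNzRingType) (p q : R) (n : nat)
    (F : nat -> R) :
  \sum_(k < n.+2) k%:R * F k * (p ^+ k * q ^+ (n.+1 - k) *+ 'C(n.+1, k)) =
  n.+1%:R * p * \sum_(k < n.+1) F k.+1 * (p ^+ k * q ^+ (n - k) *+ 'C(n, k)).
Proof.
rewrite big_ord_recl /= !mul0r add0r mulr_sumr; apply: eq_bigr => k _.
rewrite /bump /= add1n subSS exprS.
rewrite -(mulr_natr _ 'C(n.+1, _)) -(mulr_natr _ 'C(n, _)).
have := congr1 (fun x : nat => x%:R : R) (mul_bin_diag n.+1 k).
rewrite !natrM /= => E; set f := F _; set a := p ^+ k; set b := q ^+ _.
transitivity (p * f * a * b * (k.+1%:R * 'C(n.+1, k.+1)%:R)); first by ring.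
by rewrite -E; ring.
Qed.

Lemma sum_binomial_pmf (R : comNzRingType) (p q : R) (n : nat) :
  p + q = 1 ->
  \sum_(k < n.+1) p ^+ k * q ^+ (n - k) *+ 'C(n, k) = 1.
Proof.
move=> pq; rewrite -(expr1n R n) -pq addrC exprDn.
by apply: eq_bigr => k _; rewrite mulrC.
Qed.

Lemma sum_binomial_mean (R : comNzRingType) (p q : R) (n : nat) :
  p + q = 1 ->
  \sum_(k < n.+1) k%:R * (p ^+ k * q ^+ (n - k) *+ 'C(n, k)) = n%:R * p.
Proof.
move=> pq; case: n => [|n]; first by rewrite big_ord1 !mul0r.
transitivity (\sum_(k < n.+2) k%:R * (fun=> 1) (k : nat) *
    (p ^+ k * q ^+ (n.+1 - k) *+ 'C(n.+1, k))).
  by apply: eq_bigr => k _; rewrite mulr1.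
rewrite [LHS](sum_binomial_size_bias p q n (fun=> 1)) /=.
under eq_bigr do rewrite mul1r.
by rewrite sum_binomial_pmf// mulr1.
Qed.

Lemma sum_binomial_second_moment (R : comNzRingType) (p q : R) (n : nat) :
  p + q = 1 ->
  \sum_(k < n.+1) k%:R ^+ 2 * (p ^+ k * q ^+ (n - k) *+ 'C(n, k)) =
  n%:R * (n%:R - 1) * p ^+ 2 + n%:R * p.
Proof.
move=> pq; case: n => [|n]; first by rewrite big_ord1 expr0n /= !mul0r addr0.
transitivity (\sum_(k < n.+2) k%:R * (fun k => k%:R) (k : nat) *
    (p ^+ k * q ^+ (n.+1 - k) *+ 'C(n.+1, k))).
  by apply: eq_bigr => k _; rewrite expr2.
rewrite [LHS](sum_binomial_size_bias p q n (fun k => k%:R)) /=.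
under eq_bigr do rewrite -natr1 mulrDl mul1r.
by rewrite big_split /= sum_binomial_mean// sum_binomial_pmf// -natr1; ring.
Qed.

Lemma sum_natS (R : comNzRingType) (m : nat) :
  2 * (\sum_(i < m) i.+1%:R) = m%:R * (m%:R + 1) :> R.
Proof.
elim: m => [|m IHm]; first by rewrite big_ord0 mulr0 mul0r.
by rewrite big_ord_recr /= mulrDr IHm -natr1; ring.
Qed.

Lemma sum_min (R : comNzRingType) (m : nat) :
  6 * (\sum_(i < m) \sum_(j < m) (minn i.+1 j.+1)%:R) =
  m%:R * (m%:R + 1) * (2 * m%:R + 1) :> R.
Proof.
elim: m => [|m IHm]; first by rewrite big_ord0 mulr0 !mul0r.
rewrite big_ord_recr /= big_ord_recr /= minnn.
under eq_bigr do rewrite big_ord_recr /=.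
rewrite big_split /=.
under [X in _ + X + _]eq_bigr => i _ do
  rewrite (minn_idPl (ltnW (ltn_ord i : (i.+1 < m.+1)%N))).
under [X in _ + (X + _)]eq_bigr => i _ do
  rewrite (minn_idPr (ltnW (ltn_ord i : (i.+1 < m.+1)%N))).
have := @sum_natS R m; set s := \sum_(i < m) i.+1%:R => Es.
rewrite !mulrDr IHm (_ : 6 * s = 3 * (2 * s)); last by ring.
by rewrite Es -natr1; ring.
Qed.

(** * Conditional law of a Poisson increment *)

Lemma cond_probE d (T : measurableType d) (R : realType) (P : probability T R)
    (A : set T) (mA : measurable A) (B : set T) :
  P A != 0%E -> cond_prob P mA B = (P (B `&` A) * (fine (P A))^-1%:E)%E.
Proof.
move=> A0; rewrite /cond_prob /= /mnormalize /= /mrestr /= !setTI (negbTE A0) /=.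
by rewrite lt_eqF// (le_lt_trans (probability_le1 P mA)) ?ltry.
Qed.

(** The first count takes countably many values, and is a constant on each piece
    of the corresponding partition. *)
Lemma measurable_count_op d (T : measurableType d) (R : realType)
    (P : probability T R) (X Y : {RV P >-> nat}) (op : nat -> nat -> nat)
    (k : nat) :
  measurable [set w | op (X w) (Y w) = k].
Proof.
have -> : [set w | op (X w) (Y w) = k] =
    \bigcup_i ([set w | X w = i] `&` Y @^-1` [set j | op i j = k]).
  by apply/seteqP; split=> [w /= <-|w [i _ [/= -> ]]]; first exists (X w).
apply: bigcupT_measurable => i; apply: measurableI.
  exact: measurable_count_eq.
exact: measurable_funPTI.
Qed.

(** The binomial theorem in the form in which it adds independent Poisson
    counts, with the exponential factors left out. *)
Lemma poisson_convolution (R : numFieldType) (x y : R) (m : nat) :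
  \sum_(i < m.+1) (x ^+ i / i`!%:R) * (y ^+ (m - i) / (m - i)`!%:R) =
  (x + y) ^+ m / m`!%:R.
Proof.
have fact_neq0 (j : nat) : (j`!%:R : R) != 0 by rewrite pnatr_eq0 -lt0n fact_gt0.
rewrite (addrC x) exprDn mulr_suml; apply: eq_bigr => i _.
have := congr1 (fun z : nat => z%:R : R) (@bin_fact m i (ltn_ord i)).
rewrite !natrM => <-.
have := fact_neq0 i; have := fact_neq0 (m - i)%N.
have : ('C(m, i)%:R : R) != 0 by rewrite pnatr_eq0 -lt0n bin_gt0 -ltnS.
by move=> *; field; apply/and3P.
Qed.

Section poisson.
Context d (T : measurableType d) (R : realType) (P : probability T R).
Variables (lambda : R) (N : R -> {RV P >-> nat}).
Hypothesis lambda_gt0 : 0 < lambda.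
Hypothesis HN : poisson_process lambda N.

(** Including the empty interval, where the formula reads [0 ^ k / k!] and gives
    the point mass at [0].  At rate [0] the function [poisson_pmf]
    is constantly [1], so the formula is written out; it lets an interval start
    at [0] or end at [t] without a case distinction. *)
Lemma poisson_increment_law_le (s t : R) (k : nat) : 0 <= s -> s <= t ->
  P [set w | (N t w - N s w)%N = k] =
  ((lambda * (t - s)) ^+ k / k`!%:R * expR (- (lambda * (t - s))))%:E.
Proof.
move=> s0; rewrite le_eqVlt => /predU1P[->|st].
  rewrite subrr mulr0 oppr0 expR0 mulr1.
  under [X in P X]eq_set do rewrite subnn.
  case: k => [|k].
    rewrite (_ : [set _ | _] = setT) ?probability_setT ?divr1 //.
    by apply/seteqP; split.
  rewrite (_ : [set _ | _] = set0) ?measure0 ?expr0n ?mul0r//.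
  by apply/seteqP; split.
rewrite (poisson_increment_law HN)// /poisson_pmf.
by rewrite mulr_gt0// subr_gt0.
Qed.

Lemma poisson_joint_law (a b t : R) (i j k : nat) : 0 <= a -> a <= b -> b <= t ->
  P [set w | [/\ N a w = i, (N b w - N a w)%N = j & (N t w - N b w)%N = k]] =
  ((lambda * a) ^+ i / i`!%:R * ((lambda * (b - a)) ^+ j / j`!%:R) *
   ((lambda * (t - b)) ^+ k / k`!%:R) * expR (- (lambda * t)))%:E.
Proof.
move=> a0 ab bt.
pose u := nth t [:: 0; a; b].
have u_nd : nondecreasing_seq u.
  by apply/nondecreasing_seqP => -[|[|[|m]]] //=; rewrite /u /= ?nth_nil.
pose B (l : 'I_3) : set nat := [set nth 0%N [:: i; j; k] l].
have := poisson_independent_increments HN (m := 3) (lexx _) u_nd (B := B).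
move=> /(_ (fun=> _)) => indep.
transitivity (P (\bigcap_(l in [set: 'I_3])
    (fun w => (N (u l.+1) w - N (u l) w)%N) @^-1` B l)).
  congr (P _); apply/seteqP; split => w /=.
    move=> [wi wj wk] [[|[|[|//]]] lt3] _ //=.
    by rewrite (poisson_start HN) subn0.
  move=> h; have := h ord0 I; have := h (inord 1) I; have := h (inord 2) I.
  by rewrite /B /= !inordK//= (poisson_start HN) subn0.
rewrite indep// !big_ord_recr big_ord0 /= mul1e.
rewrite !poisson_increment_law_le// ?(le_trans a0)// -!EFinM subr0.
congr (_%:E).
have -> : - (lambda * t) = - (lambda * a) - lambda * (b - a) - lambda * (t - b).
  by ring.
by rewrite !expRD; ring.
Qed.

Lemma poisson_count_law (t : R) (n : nat) : 0 <= t ->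
  P [set w | N t w = n] = ((lambda * t) ^+ n / n`!%:R * expR (- (lambda * t)))%:E.
Proof.
move=> t0; rewrite -[in RHS](subr0 t) -poisson_increment_law_le//.
by under [X in _ = P X]eq_set do rewrite (poisson_start HN) subn0.
Qed.

Lemma poisson_count_neq0 (t : R) (n : nat) : 0 < t ->
  P [set w | N t w = n] != 0%E.
Proof.
move=> t0; rewrite poisson_count_law ?ltW// eqe gt_eqF// mulr_gt0 ?expR_gt0//.
by rewrite divr_gt0 ?exprn_gt0 ?mulr_gt0// ltr0n fact_gt0.
Qed.

(** The points outside the interval form a Poisson number of rate
    [lambda * (t - (b - a))]: sum the joint law over the number of points
    before [a]. *)
Lemma poisson_increment_count_law (a b t : R) (n k : nat) :
  0 <= a -> a <= b -> b <= t -> (k <= n)%N ->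
  P ([set w | (N b w - N a w)%N = k] `&` [set w | N t w = n]) =
  ((lambda * (b - a)) ^+ k / k`!%:R *
   ((lambda * (t - (b - a))) ^+ (n - k) / (n - k)`!%:R) *
   expR (- (lambda * t)))%:E.
Proof.
move=> a0 ab bt kn.
pose E (i : 'I_(n - k).+1) := [set w | [/\ N a w = i, (N b w - N a w)%N = k &
   (N t w - N b w)%N = (n - k - i)%N]].
have mono w : (N a w <= N b w <= N t w)%N.
  by rewrite !(poisson_nondecreasing HN)// (le_trans a0).
have -> : [set w | (N b w - N a w)%N = k] `&` [set w | N t w = n] =
    \big[setU/set0]_(i < (n - k).+1) E i.
  rewrite -(bigcup_mkord_ord E).
  apply/seteqP; split => [w [/= wk wn]|w [i /= _]].
    have /andP[? ?] := mono w.
    have lt_a : (N a w < (n - k).+1)%N by lia.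
    exists (N a w) => //=; rewrite /E /= inordK//; split => //; lia.
  have /andP[? ?] := mono w; have := ltn_ord (inord i : 'I_(n - k).+1).
  by move=> ? [? ? ?]; split => /=; lia.
rewrite measure_bigsetU_ord//; last 2 first.
- move=> i; rewrite /E.
  rewrite (_ : [set _ | _] = [set w | N a w = i] `&`
    [set w | (N b w - N a w)%N = k] `&`
    [set w | (N t w - N b w)%N = (n - k - i)%N]).
    apply: measurableI; first apply: measurableI.
    - exact: measurable_count_eq.
    - exact: (measurable_count_op (N b) (N a) subn).
    - exact: (measurable_count_op (N t) (N b) subn).
  by apply/seteqP; split => w /= => [[? ? ?]|[[? ?] ?]].
- move=> i j _ _ [w [[wi _ _] [wj _ _]]]; apply: val_inj.
  by rewrite /= -wi -wj.
under eq_bigr => i _ do rewrite /E /= poisson_joint_law//.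
rewrite sumEFin; congr (_%:E).
have -> : lambda * (t - (b - a)) = lambda * a + lambda * (t - b) by ring.
rewrite -poisson_convolution mulr_sumr mulr_suml; apply: eq_bigr => i _.
by ring.
Qed.

Lemma poisson_cond_increment_law (a b t : R) (n k : nat) :
  0 <= a -> a <= b -> b <= t -> 0 < t -> (k <= n)%N ->
  cond_prob P (measurable_count_eq (N t) n) [set w | (N b w - N a w)%N = k] =
  (((b - a) / t) ^+ k * (1 - (b - a) / t) ^+ (n - k) *+ 'C(n, k))%:E.
Proof.
move=> a0 ab bt t0 kn.
rewrite cond_probE; last exact: poisson_count_neq0.
rewrite poisson_increment_count_law// poisson_count_law ?ltW// -EFinM /=.
congr (_%:E).
have -> : 1 - (b - a) / t = (t - (b - a)) / t by field; rewrite gt_eqF.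
have fact_neq0 (j : nat) : (j`!%:R : R) != 0 by rewrite pnatr_eq0 -lt0n fact_gt0.
have := congr1 (fun z : nat => z%:R : R) (@bin_fact n k kn).
rewrite !natrM => <-.
have splitX (x : R) : x ^+ n = x ^+ k * x ^+ (n - k) by rewrite -exprD subnKC.
rewrite !exprMn !exprVn (splitX lambda) (splitX t).
have e0 : expR (- (lambda * t)) != 0 by rewrite gt_eqF ?expR_gt0.
have bin0 : ('C(n, k)%:R : R) != 0 by rewrite pnatr_eq0 -lt0n bin_gt0.
field.
by rewrite e0 bin0 !fact_neq0 !expf_neq0 ?gt_eqF.
Qed.

End poisson.

(** * Integrals of bounded functions over an event *)

Lemma measurable_count d (T : measurableType d) (R : realType)
    (P : probability T R) (X : {RV P >-> nat}) :
  measurable_fun [set: T] (fun w => (X w)%:R : R).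
Proof.
by apply: (@measurableT_comp _ _ _ _ _ _ (fun k : nat => k%:R : R)).
Qed.

Section finite_measure_integrals.
Context d (T : measurableType d) (R : realType).
Variables (mu : {finite_measure set T -> \bar R}) (A : set T).
Hypothesis mA : measurable A.

Lemma bounded_integrable (f : T -> R) (C : R) :
  measurable_fun A f -> (forall w, A w -> `|f w| <= C) ->
  mu.-integrable A (EFin \o f).
Proof.
move=> mf fC; apply: measurable_bounded_integrable => //.
  by rewrite ltey_eq fin_num_measure.
exists C; split; first exact: num_real.
by move=> M /= CM w Aw; rewrite (le_trans (fC w Aw)) ?ltW.
Qed.

Lemma integrable_EFin_sum (I : Type) (s : seq I) (f : I -> T -> R) :
  (forall i, mu.-integrable A (EFin \o f i)) ->
  mu.-integrable A (EFin \o (fun w => \sum_(i <- s) f i w)).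
Proof.
move=> If; rewrite (_ : EFin \o _ = (fun w => \sum_(i <- s) (f i w)%:E)%E).
  by apply: (integrable_sum mA s) => i _; exact: If.
by apply/funext => w; rewrite /= sumEFin.
Qed.

Lemma Rintegral_sum (I : Type) (s : seq I) (f : I -> T -> R) :
  (forall i, mu.-integrable A (EFin \o f i)) ->
  \int[mu]_(w in A) (\sum_(i <- s) f i w) = \sum_(i <- s) \int[mu]_(w in A) f i w.
Proof.
move=> If; rewrite /Rintegral.
under eq_integral do rewrite -sumEFin.
rewrite (integral_sum mA (f := fun i w => (f i w)%:E))// sum_fine// => i _.
exact: (integrable_fin_num mA (If i)).
Qed.

(** On [A] the variable is a finite combination of indicators of its level
    sets. *)
Lemma Rintegral_count (D : T -> nat) (F : nat -> R) (n : nat) :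
  (forall k, measurable [set w | D w = k]) -> (forall w, A w -> (D w <= n)%N) ->
  \int[mu]_(w in A) F (D w) =
  \sum_(k < n.+1) F k * fine (mu ([set w | D w = k] `&` A)).
Proof.
move=> mD Dn.
pose g (k : 'I_n.+1) w := F k * \1_[set w | D w = k] w.
have mg k : measurable_fun A (g k).
  by apply: measurable_funM => //; exact: measurable_indic.
have gE w : A w -> F (D w) = \sum_(k < n.+1) g k w.
  move=> Aw; rewrite (bigD1 (Ordinal (Dn w Aw : (D w < n.+1)%N)))//= /g.
  rewrite indicE mem_set//= mulr1 big1 ?addr0// => k /eqP kD.
  by rewrite indicE memNset ?mulr0//= => Dk; apply: kD; apply: val_inj.
have Ind k : mu.-integrable A (EFin \o \1_[set w | D w = k]).
  apply: (@bounded_integrable _ 1); first exact: measurable_indic.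
  by move=> w _; rewrite indicE; case: (_ \in _); rewrite ?normr1 ?normr0 ?ler01.
transitivity (\int[mu]_(w in A) (\sum_(k < n.+1) g k w)).
  by apply: eq_Rintegral => w; rewrite inE; exact: gE.
rewrite Rintegral_sum => [|k]; last first.
  apply: (@bounded_integrable _ `|F k|) => // w _; rewrite /g normrM.
  by rewrite indicE; case: (_ \in _); rewrite ?normr1 ?normr0 ?mulr1 ?mulr0.
apply: eq_bigr => k _; rewrite /g RintegralZl//.
by rewrite /Rintegral integral_indic.
Qed.

(** Bounded convergence, in the form used to pass from closed forms for the
    approximations to the value for the limit. *)
Lemma Rintegral_bounded_cvg (f_ : nat -> T -> R) (f : T -> R) (c : nat -> R)
    (C l : R) :
  (forall m, measurable_fun A (f_ m)) ->
  (forall m w, A w -> `|f_ m w| <= C) ->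
  (forall w, A w -> f_ m w @[m --> \oo] --> f w) ->
  (forall m, \int[mu]_(w in A) f_ m w = c m) -> c m @[m --> \oo] --> l ->
  \int[mu]_(w in A) f w = l.
Proof.
move=> mf fC f_f fc cl.
have If m : mu.-integrable A (EFin \o f_ m) by exact: bounded_integrable (fC m).
have cvg1 : (\int[mu]_(w in A) (f_ m w)%:E)%E @[m --> \oo] -->
    (\int[mu]_(w in A) (f w)%:E)%E.
  apply: (@dominated_cvg _ _ _ mu A mA _ _ (EFin \o cst C)) => //.
  - by move=> m; exact/measurable_EFinP.
  - by move=> w Aw; apply: cvg_EFin; [exact: nearW|exact: f_f].
  - by apply: (@bounded_integrable _ `|C|).
have cvg2 : (\int[mu]_(w in A) (f_ m w)%:E)%E @[m --> \oo] --> l%:E.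
  rewrite (_ : (fun m => _) = EFin \o c).
    by apply: cvg_EFin; [exact: nearW|exact: cl].
  apply/funext => m /=; rewrite -fc /Rintegral fineK//.
  exact: (integrable_fin_num mA (If m)).
by rewrite /Rintegral (cvg_unique _ cvg1 cvg2).
Qed.

End finite_measure_integrals.

(** * Expectation and variance under a conditional probability *)

Section expectation_under_cond_prob.
Context d (T : measurableType d) (R : realType) (P : probability T R).
Variables (A : set T) (mA : measurable A).
Hypothesis PA_neq0 : P A != 0%E.
Local Notation Q := (cond_prob P mA).

Lemma cond_prob_condition : Q A = 1%E.
Proof.
have PAfin : P A \is a fin_num by exact: fin_num_measure.
rewrite cond_probE// setIid -[X in (X * _)%E]fineK// -EFinM divff//.
by rewrite fine_eq0.
Qed.

Lemma cond_prob_setIr (B : set T) : Q (B `&` A) = Q B.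
Proof. by rewrite !cond_probE// -setIA setIid. Qed.

(** The complement of [A] is null, so a bound for [f] on [A] is enough for the
    expectation to be finite and computed on [A]. *)
Lemma cond_expectationE (f : T -> R) (C : R) :
  measurable_fun [set: T] f -> (forall w, A w -> `|f w| <= C) ->
  'E_Q[f]%E = (\int[Q]_(w in A) f w)%:E.
Proof.
move=> mf fC.
have QAC : Q (~` A) = 0%E by rewrite cond_probE// setICl measure0 mul0e.
have mfA : measurable_fun A f by exact: measurable_funTS.
have If := bounded_integrable Q mA mfA fC.
have TA : [set: T] `\` ~` A = A by rewrite setTD setCK.
have IfT : Q.-integrable [set: T] (EFin \o f).
  rewrite (negligible_integrable _ _ _ QAC) ?TA//; first exact: measurableC.
  exact/measurable_EFinP.
rewrite unlock (negligible_integral _ _ IfT QAC)//; last exact: measurableC.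
by rewrite TA /Rintegral fineK//; exact: (integrable_fin_num mA If).
Qed.

Lemma cond_varianceE (f : T -> R) (C e v : R) :
  measurable_fun [set: T] f -> (forall w, A w -> `|f w| <= C) ->
  \int[Q]_(w in A) f w = e -> \int[Q]_(w in A) f w ^+ 2 = v ->
  'V_Q[f]%E = (v - e ^+ 2)%:E.
Proof.
move=> mf fC fe fv.
have mf2 : measurable_fun [set: T] (fun w => f w ^+ 2) by exact: measurable_funX.
have f2C w : A w -> `|f w ^+ 2| <= C ^+ 2.
  by move=> Aw; rewrite normrX lerXn2r ?nnegrE ?(le_trans _ (fC w Aw)) ?fC.
have Icst c : Q.-integrable A (EFin \o cst c).
  by apply: (@bounded_integrable _ _ _ _ _ mA _ `|c|).
have If : Q.-integrable A (EFin \o f).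
  by apply: (bounded_integrable _ mA _ fC) => //; exact: measurable_funTS.
have If2 : Q.-integrable A (EFin \o (fun w => f w ^+ 2)).
  by apply: (bounded_integrable _ mA _ f2C) => //; exact: measurable_funTS.
have Ief : Q.-integrable A (EFin \o (fun w => - (2 * e) * f w)).
  exact: (integrableZl mA _ If).
rewrite /variance unlock (cond_expectationE mf fC) fe /=.
rewrite (_ : _ * _ = fun w => (f w - e) ^+ 2)%R; last first.
  by apply/funext => w; rewrite expr2.
rewrite (@cond_expectationE _ ((C + `|e|) ^+ 2)); last 2 first.
- by apply: measurable_funX; apply: measurable_funB.
- move=> w Aw /=; have fCw := le_trans (normr_ge0 _) (fC w Aw).
  rewrite normrX lerXn2r ?nnegrE ?addr_ge0//.
  by rewrite (le_trans (ler_normB _ _))// lerD// fC.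
congr (_%:E).
transitivity (\int[Q]_(w in A) (f w ^+ 2 + (- (2 * e) * f w + cst (e ^+ 2) w))).
  by apply: eq_Rintegral => w _ /=; ring.
rewrite RintegralD//; last exact: (integrableD mA Ief (Icst _)).
have fineQA : fine (Q A) = 1 by rewrite cond_prob_condition.
rewrite RintegralD// RintegralZl// fe fv Rintegral_cst// [fine _]fineQA.
by ring.
Qed.

End expectation_under_cond_prob.

(** * The path integral as a limit of Riemann sums *)

Lemma cvg_sqr (R : realType) (u : nat -> R) (l : R) :
  u m @[m --> \oo] --> l -> u m ^+ 2 @[m --> \oo] --> l ^+ 2.
Proof. by move=> ul; under eq_fun do rewrite expr2; exact: cvgM. Qed.

Section poisson_paths.
Context d (T : measurableType d) (R : realType) (P : probability T R).
Variables (lambda : R) (N : R -> {RV P >-> nat}).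
Hypothesis HN : poisson_process lambda N.

(** The mesh is [t / m.+1], so that the sequence starts with a single cell. *)
Definition path_riemann_sum (t : R) (m : nat) (w : T) : R :=
  right_riemann_sum (fun s => (N s w)%:R) (t / m.+1%:R) m.+1.

(* The path is nondecreasing only at nonnegative times.  Stopping time at [0]
   and [t] makes it nondecreasing on the whole line and keeps its values on
   [0, t]. *)
Let clip (t s : R) : R := Num.max 0 (Num.min s t).

Let clipE (t s : R) : 0 <= s -> s <= t -> clip t s = s.
Proof. by move=> s0 st; rewrite /clip min_l// max_r. Qed.

Let clip_nondecreasing (t : R) (w : T) : 0 <= t ->
  {homo (fun s => (N (clip t s) w)%:R : R) : x y / x <= y}.
Proof.
move=> t0 x y xy; rewrite ler_nat (poisson_nondecreasing HN)//.
  by rewrite /clip le_max lexx.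
rewrite /clip ge_max !le_max lexx /=; apply/orP; right.
by rewrite le_min !ge_min xy lexx orbT.
Qed.

Let path_integral_clip (t : R) (w : T) :
  path_integral N t w =
  \int[lebesgue_measure]_(s in `[0, t]) (N (clip t s) w)%:R.
Proof.
apply: eq_Rintegral => s; rewrite inE /= in_itv /= => /andP[s0 st].
by rewrite clipE.
Qed.

Lemma path_riemann_node (t : R) (m : nat) (i : 'I_m.+1) : 0 <= t ->
  0 <= i.+1%:R * (t / m.+1%:R) <= t.
Proof.
move=> t0; rewrite mulr_ge0 ?divr_ge0//=.
by rewrite mulrCA ler_piMr// ler_pdivrMr// mul1r ler_nat.
Qed.

Let path_riemann_sum_clip (t : R) (m : nat) (w : T) : 0 <= t ->
  path_riemann_sum t m w =
  right_riemann_sum (fun s => (N (clip t s) w)%:R) (t / m.+1%:R) m.+1.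
Proof.
move=> t0; rewrite /path_riemann_sum /right_riemann_sum.
congr (_ * _); apply: eq_bigr => i _.
by have /andP[? ?] := path_riemann_node i t0; rewrite clipE.
Qed.

Lemma path_riemann_sum_cvg (t : R) (w : T) : 0 <= t ->
  path_riemann_sum t m w @[m --> \oo] --> path_integral N t w.
Proof.
move=> t0; rewrite path_integral_clip.
under eq_fun do rewrite path_riemann_sum_clip//.
exact: right_riemann_sum_cvg (clip_nondecreasing w t0) t0.
Qed.

Lemma path_riemann_sum_bounds (t : R) (m : nat) (w : T) : 0 <= t ->
  0 <= path_riemann_sum t m w <= t * (N t w)%:R.
Proof.
move=> t0; rewrite /path_riemann_sum /right_riemann_sum.
rewrite mulr_ge0 ?divr_ge0 ?sumr_ge0//=.
rewrite -mulrA ler_wpM2l// mulrC ler_pdivrMr//.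
apply: (@le_trans _ _ (\sum_(i < m.+1) (N t w)%:R)); last first.
  by rewrite sumr_const card_ord mulr_natr.
apply: ler_sum => i _; have /andP[? ?] := path_riemann_node i t0.
by rewrite ler_nat (poisson_nondecreasing HN).
Qed.

(** The upper bound is the Riemann sum with a single cell. *)
Lemma path_integral_bounds (t : R) (w : T) : 0 <= t ->
  0 <= path_integral N t w <= t * (N t w)%:R.
Proof.
move=> t0; rewrite Rintegral_ge0//=.
have := @right_riemann_sum_error R _ t 1 (clip_nondecreasing w t0) t0.
rewrite mul1r -path_integral_clip /right_riemann_sum big_ord1 mul1r clipE//.
by rewrite subr_ge0 => /andP[].
Qed.

Lemma measurable_path_riemann_sum (t : R) (m : nat) :
  measurable_fun [set: T] (path_riemann_sum t m).
Proof.
apply: measurable_funM => //; apply: measurable_sum => i.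
exact: measurable_count.
Qed.

Lemma measurable_path_integral (t : R) : 0 <= t ->
  measurable_fun [set: T] (path_integral N t).
Proof.
move=> t0; apply: (@measurable_fun_cvg _ _ _ _ (path_riemann_sum t)).
  exact: measurable_path_riemann_sum.
by move=> w _; exact: path_riemann_sum_cvg.
Qed.

End poisson_paths.

(** * Conditional moments of the counts and of the path integral *)

Section conditional_moments.
Context d (T : measurableType d) (R : realType) (P : probability T R).
Variables (lambda : R) (N : R -> {RV P >-> nat}).
Hypothesis lambda_gt0 : 0 < lambda.
Hypothesis HN : poisson_process lambda N.
Variables (t : R) (n : nat).
Hypothesis t_gt0 : 0 < t.
Local Notation A := [set w | N t w = n].
Local Notation Q := (cond_prob P (measurable_count_eq (N t) n)).

Let mA : measurable A := measurable_count_eq (N t) n.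
Let t_ge0 : 0 <= t := ltW t_gt0.
Let PA_neq0 : P A != 0%E := poisson_count_neq0 lambda_gt0 HN n t_gt0.

Let N_le (a : R) (w : T) : 0 <= a -> a <= t -> A w -> (N a w <= n)%N.
Proof. by move=> a0 at_ <-; exact: (poisson_nondecreasing HN). Qed.

(** On [A] the increment takes values in [0 ... n] only, so that its conditional
    law is entirely given by the binomial weights. *)
Lemma increment_cond_moment (a b : R) (F : nat -> R) :
  0 <= a -> a <= b -> b <= t ->
  \int[Q]_(w in A) F (N b w - N a w)%N =
  \sum_(k < n.+1) F k *
    (((b - a) / t) ^+ k * (1 - (b - a) / t) ^+ (n - k) *+ 'C(n, k)).
Proof.
move=> a0 ab bt.
rewrite (Rintegral_count Q mA F (n := n)); first last.
- by move=> w Aw; rewrite (leq_trans (leq_subr _ _))// N_le// (le_trans a0).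
- by move=> k; exact: (measurable_count_op (N b) (N a) subn).
apply: eq_bigr => k _; congr (_ * _).
have kn : (k <= n)%N by rewrite -ltnS.
have law := poisson_cond_increment_law lambda_gt0 HN a0 ab bt t_gt0 kn.
by have /(congr1 fine) := etrans (cond_prob_setIr mA PA_neq0 _) law.
Qed.

Lemma count_cond_mean (a : R) : 0 <= a -> a <= t ->
  \int[Q]_(w in A) (N a w)%:R = n%:R * (a / t).
Proof.
move=> a0 at_; rewrite -(sum_binomial_mean (q := 1 - a / t)) ?subrKC//.
have := @increment_cond_moment 0 a (fun k => k%:R) (lexx _) a0 at_.
rewrite subr0 => <-; apply: eq_Rintegral => w _.
by rewrite (poisson_start HN) subn0.
Qed.

Lemma increment_cond_second_moment (a b : R) :
  0 <= a -> a <= b -> b <= t ->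
  \int[Q]_(w in A) (N b w - N a w)%N%:R ^+ 2 =
  n%:R * (n%:R - 1) * ((b - a) / t) ^+ 2 + n%:R * ((b - a) / t).
Proof.
move=> a0 ab bt.
rewrite (@increment_cond_moment a b (fun k => k%:R ^+ 2))//.
by rewrite (sum_binomial_second_moment _ (q := 1 - (b - a) / t)) ?subrKC.
Qed.

Lemma count_cond_second_moment (a : R) : 0 <= a -> a <= t ->
  \int[Q]_(w in A) (N a w)%:R ^+ 2 =
  n%:R * (n%:R - 1) * (a / t) ^+ 2 + n%:R * (a / t).
Proof.
move=> a0 at_; have := increment_cond_second_moment (lexx 0) a0 at_.
rewrite subr0 => <-; apply: eq_Rintegral => w _.
by rewrite (poisson_start HN) subn0.
Qed.

Let integrable_count2 (a b : R) : 0 <= a <= t -> 0 <= b <= t ->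
  Q.-integrable A (EFin \o (fun w => (N a w)%:R * (N b w)%:R)).
Proof.
move=> /andP[a0 at_] /andP[b0 bt].
apply: (@bounded_integrable _ _ _ _ _ mA _ (n%:R * n%:R)).
  by apply: measurable_funTS; apply: measurable_funM; exact: measurable_count.
by move=> w Aw; rewrite ger0_norm ?mulr_ge0// ler_pM// ler_nat N_le.
Qed.

(** Polarisation, [2 x y = x ^ 2 + y ^ 2 - (y - x) ^ 2], reduces the product to
    squares of single increments. *)
Lemma count_cond_product (a b : R) : 0 <= a -> a <= b -> b <= t ->
  \int[Q]_(w in A) ((N a w)%:R * (N b w)%:R) =
  n%:R * (n%:R - 1) * (a / t) * (b / t) + n%:R * (a / t).
Proof.
move=> a0 ab bt; have b0 := le_trans a0 ab; have at_ := le_trans ab bt.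
have ha : 0 <= a <= t by rewrite a0.
have hb : 0 <= b <= t by rewrite b0.
have := increment_cond_second_moment a0 ab bt.
have -> : \int[Q]_(w in A) (N b w - N a w)%N%:R ^+ 2 =
    \int[Q]_(w in A) ((N a w)%:R * (N a w)%:R +
      ((N b w)%:R * (N b w)%:R + - 2 * ((N a w)%:R * (N b w)%:R))).
  apply: eq_Rintegral => w _.
  by rewrite natrB ?(poisson_nondecreasing HN)//; ring.
have Iab := integrable_count2 ha hb.
have Iab2 : Q.-integrable A (EFin \o (fun w => - 2 * ((N a w)%:R * (N b w)%:R))).
  exact: (integrableZl mA _ Iab).
have Iaa := integrable_count2 ha ha; have Ibb := integrable_count2 hb hb.
rewrite RintegralD//; last exact: (integrableD mA Ibb Iab2).
rewrite RintegralD// RintegralZl//.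
have := count_cond_second_moment a0 at_; have := count_cond_second_moment b0 bt.
under eq_Rintegral do rewrite expr2; move=> ->.
under eq_Rintegral do rewrite expr2; move=> ->.
rewrite mulrBl => h.
by apply: (@mulfI _ 2) => //; lra.
Qed.

Lemma path_riemann_sum_cond_mean (m : nat) :
  \int[Q]_(w in A) path_riemann_sum N t m w =
  n%:R * t / 2 * (1 + m.+1%:R^-1).
Proof.
have h0 : 0 <= t / m.+1%:R by rewrite divr_ge0.
have hi (i : 'I_m.+1) := andP (path_riemann_node i t_ge0).
have Ii (i : 'I_m.+1) :
    Q.-integrable A (EFin \o (fun w => (N (i.+1%:R * (t / m.+1%:R)) w)%:R)).
  apply: (@bounded_integrable _ _ _ _ _ mA _ n%:R).
    by apply: measurable_funTS; exact: measurable_count.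
  by move=> w Aw; have [? ?] := hi i; rewrite ger0_norm// ler_nat N_le.
rewrite /path_riemann_sum /right_riemann_sum.
rewrite RintegralZl//; last first.
  exact: (integrable_EFin_sum mA).
rewrite (Rintegral_sum mA)//.
under eq_bigr => i _ do rewrite count_cond_mean ?(proj1 (hi i)) ?(proj2 (hi i))//.
rewrite -mulr_sumr.
under eq_bigr => i _ do rewrite -!mulrA.
rewrite -mulr_suml.
have := sum_natS R m.+1; set s := \sum_(i < _) _ => Es.
have -> : s = m.+1%:R * (m.+1%:R + 1) / 2 by rewrite -Es mulrC mulKf.
by field; rewrite nat1r pnatr_eq0 (gt_eqF t_gt0).
Qed.

(** Expanding the square gives a double sum of conditional products; its two
    parts are the square of [1 + ... + m.+1] and the sum of [min(i, j)]. *)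
Lemma path_riemann_sum_cond_second_moment (m : nat) :
  \int[Q]_(w in A) path_riemann_sum N t m w ^+ 2 =
  n%:R * (n%:R - 1) * (t ^+ 2 / 4) * (1 + m.+1%:R^-1) ^+ 2 +
  n%:R * (t ^+ 2 / 6) * (1 + m.+1%:R^-1) * (2 + m.+1%:R^-1).
Proof.
set h := t / m.+1%:R.
have h0 : 0 <= h by rewrite divr_ge0.
have hi (i : 'I_m.+1) := path_riemann_node i t_ge0.
pose u (i : 'I_m.+1) := i.+1%:R * h.
have Iij (ij : 'I_m.+1 * 'I_m.+1) := integrable_count2 (hi ij.1) (hi ij.2).
have prod_ij (i j : 'I_m.+1) :
    \int[Q]_(w in A) ((N (u i) w)%:R * (N (u j) w)%:R) =
    n%:R * (n%:R - 1) * (h / t) ^+ 2 * (i.+1%:R * j.+1%:R) +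
    n%:R * (h / t) * (minn i.+1 j.+1)%:R.
  (* Both sides are symmetric in the two nodes. *)
  wlog le_ij : i j / (i <= j)%N => [hwlog|].
    have [/hwlog//|/ltnW/hwlog] := leqP i j.
    rewrite minnC (mulrC j.+1%:R) => <-.
    by apply: eq_Rintegral => w _; rewrite mulrC.
  have /andP[ui0 uit] := hi i; have /andP[uj0 ujt] := hi j.
  have uij : u i <= u j by rewrite ler_wpM2r// ler_nat.
  rewrite count_cond_product// (minn_idPl (le_ij : (i.+1 <= j.+1)%N)) /u.
  by ring.
transitivity (\int[Q]_(w in A) (h ^+ 2 *
    \sum_(ij : 'I_m.+1 * 'I_m.+1) (N (u ij.1) w)%:R * (N (u ij.2) w)%:R)).
  apply: eq_Rintegral => w _.
  rewrite /path_riemann_sum /right_riemann_sum -/h exprMn.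
  rewrite [(\sum_(i < _) _) ^+ 2]expr2 big_distrlr /=.
  by rewrite pair_big.
rewrite RintegralZl//; last first.
  exact: (integrable_EFin_sum mA).
rewrite (Rintegral_sum mA)//.
under eq_bigr do rewrite prod_ij.
rewrite big_split /= -!mulr_sumr.
rewrite -(pair_big predT predT (fun i j : 'I_m.+1 => i.+1%:R * j.+1%:R)) /=.
rewrite -(pair_big predT predT (fun i j : 'I_m.+1 => (minn i.+1 j.+1)%:R)) /=.
rewrite -big_distrlr /=.
have := sum_natS R m.+1; set s := \sum_(i < _) _ => Es.
have -> : s = m.+1%:R * (m.+1%:R + 1) / 2 by rewrite -Es mulrC mulKf.
have := sum_min R m.+1; set s2 := \sum_(i < _) _ => Es2.
have -> : s2 = m.+1%:R * (m.+1%:R + 1) * (2 * m.+1%:R + 1) / 6.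
  by rewrite -Es2 mulrC mulKf.
by rewrite /h; field; rewrite nat1r pnatr_eq0 (gt_eqF t_gt0).
Qed.

Lemma path_integral_cond_mean :
  \int[Q]_(w in A) path_integral N t w = n%:R * t / 2.
Proof.
apply: (Rintegral_bounded_cvg mA (f_ := path_riemann_sum N t) (C := t * n%:R)
  _ _ _ path_riemann_sum_cond_mean).
- by move=> m; apply: measurable_funTS; exact: measurable_path_riemann_sum.
- move=> m w Aw; have /andP[S0 St] := path_riemann_sum_bounds HN m w t_ge0.
  by rewrite ger0_norm// -Aw.
- by move=> w _; exact: (path_riemann_sum_cvg HN).
rewrite -[X in _ --> X]mulr1; apply: cvgMl_tmp.
rewrite -[X in _ --> X]addr0; apply: cvgD; first exact: cvg_cst.
exact: cvg_harmonic.
Qed.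

Lemma path_integral_cond_second_moment :
  \int[Q]_(w in A) path_integral N t w ^+ 2 =
  n%:R * (3 * n%:R + 1) * t ^+ 2 / 12.
Proof.
apply: (Rintegral_bounded_cvg mA (f_ := fun m w => path_riemann_sum N t m w ^+ 2)
  (C := (t * n%:R) ^+ 2) _ _ _ path_riemann_sum_cond_second_moment).
- move=> m; apply: measurable_funTS; apply: measurable_funX.
  exact: measurable_path_riemann_sum.
- move=> m w Aw; have /andP[S0 St] := path_riemann_sum_bounds HN m w t_ge0.
  move: St; rewrite (Aw : N t w = n) => St.
  by rewrite normrX ger0_norm// lerXn2r ?nnegrE// mulr_ge0.
- move=> w _; apply: cvg_sqr; exact: (path_riemann_sum_cvg HN).
have inv_cvg (c : R) : c + m.+1%:R^-1 @[m --> \oo] --> c.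
  rewrite -[X in _ --> X]addr0; apply: cvgD; first exact: cvg_cst.
  exact: cvg_harmonic.
have -> : n%:R * (3 * n%:R + 1) * t ^+ 2 / 12 =
    n%:R * (n%:R - 1) * (t ^+ 2 / 4) * 1 ^+ 2 + n%:R * (t ^+ 2 / 6) * 1 * 2.
  by field.
apply: cvgD; last by apply: cvgM => //; apply: cvgMl_tmp.
by apply: cvgMl_tmp; exact: cvg_sqr.
Qed.

End conditional_moments.

Theorem theorem4p3 (d : measure_display) (T : measurableType d) (R : realType)
    (P : probability T R) (lambda : R) (N : R -> {RV P >-> nat})
    (lambda_gt0 : 0 < lambda) (HN : poisson_process lambda N)
    (t : R) (t_gt0 : 0 < t) (n : nat) :
  let Pn := cond_prob P (measurable_count_eq (N t) n) in
  'E_Pn[fun w => (path_integral N t w ^+ 2)%R]%E =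
    (n%:R * (3 * n%:R + 1) * t ^+ 2 / 12)%:E /\
  'V_Pn[path_integral N t]%E = (n%:R * t ^+ 2 / 12)%:E.
Proof.
move=> /=; have t_ge0 := ltW t_gt0.
pose mA := measurable_count_eq (N t) n.
have PA_neq0 := poisson_count_neq0 lambda_gt0 HN n t_gt0.
have mI := measurable_path_integral HN t_ge0.
have I_le w : N t w = n -> `|path_integral N t w| <= t * n%:R.
  move=> <-; have /andP[I0 It] := path_integral_bounds HN w t_ge0.
  by rewrite ger0_norm.
have mean := path_integral_cond_mean lambda_gt0 HN n t_gt0.
have second := path_integral_cond_second_moment lambda_gt0 HN n t_gt0.
split.
- rewrite (cond_expectationE mA PA_neq0 (C := (t * n%:R) ^+ 2)) ?second//.
    exact: measurable_funX.
  move=> w Aw; rewrite normrX lerXn2r ?nnegrE ?mulr_ge0//.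
  exact: I_le.
- rewrite (cond_varianceE PA_neq0 mI I_le mean second); congr (_%:E).
  by field.
Qed.
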